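(* Let $G=(V,\mathcal E,w)$ be an undirected, connected, weighted graph on $n$ nodes. Let: - $E\in\mathbb R^{n\times|\mathcal E|}$ be its signed incidence matrix (arbitrary orientation); - $W=\mathrm{diag}(w(e))$; - $L=EWE^T$, with largest eigenvalue $\lambda_n$. Let $\tau\ge0$ with $\tau\lambda_n<\pi/2$. Consider the consensus network with measurement noise on the links, $$\dot x(t)=-L\,x(t-\tau)-E\,\xi(t),\qquad y=M_nx,$$ where $(\xi_e)_{e\in\mathcal E}$ are mutually independent zero-mean Gaussian white noises with intensities $\sigma_e^2$. Then for every link $e=\{i,j\}\in\mathcal E$, $$\nu_e=\frac12\,r_e\Big(L\cos(\tau L)^{-1}\big(M_n-\sin(\tau L)\big)\Big).$$
   Context: Notation: - $M_n=I_n-\frac1n\mathbf1\mathbf1^T$. - $X^\dagger$ is the Moore–Penrose pseudo-inverse. - $\cos(X)$ and $\sin(X)$ are the matrix power-series functions; $\cos(\tau L)$ is invertible since $\tau\lambda_n<\pi/2$. - For a symmetric matrix $X$ and $e=\{i,j\}$, $r_e(X)=[X^\dagger]_{ii}+[X^\dagger]_{jj}-2[X^\dagger]_{ij}$. The performance is $$\rho_{ss}=\lim_{t\to\infty}\mathbb E[y^Ty]=\frac1{2\pi}\int\mathrm{Tr}[G(j\omega)^HG(j\omega)]d\omega,\qquad G(s)=M_n(sI+e^{-\tau s}L)^{-1}(-E)\,\mathrm{diag}(\sigma_e).$$ The link centrality is $\nu_e=\partial\rho_{ss}/\partial\sigma_e^2$. *)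

(* Defs.v *)
From HB Require Import structures.
From mathcomp Require Import all_boot all_order all_algebra.
From mathcomp Require Import all_classical all_reals all_analysis.
From mathcomp Require Import complex.
Set Implicit Arguments. Unset Strict Implicit. Unset Printing Implicit Defensive.
Import Order.TTheory GRing.Theory Num.Theory.
Local Open Scope ring_scope.
Local Open Scope classical_set_scope.

Section Defs.
Variable R : realType.

Definition centering (n : nat) : 'M[R]_n := 1%:M - (n%:R)^-1 *: const_mx 1.

Definition incidence (n m : nat) (src dst : 'I_m -> 'I_n) : 'M[R]_(n, m) :=
  \matrix_(i, k) (if i == src k then 1 else if i == dst k then -1 else 0).

Definition laplacian (n m : nat) (src dst : 'I_m -> 'I_n) (w : 'I_m -> R)
  : 'M[R]_n :=
  incidence src dst *m diag_mx (\row_k w k) *m (incidence src dst)^T.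

Definition graph_adj (n m : nat) (src dst : 'I_m -> 'I_n) : rel 'I_n :=
  fun i j => [exists k, ((src k == i) && (dst k == j))
                        || ((src k == j) && (dst k == i))].

Definition mx_cos (n : nat) (A : 'M[R]_n) : 'M[R]_n :=
  \matrix_(i, j) limn (fun N => \sum_(0 <= k < N)
     ((-1) ^+ k / ((2 * k)`!)%:R * (A ^+ (2 * k)) i j)).
Definition mx_sin (n : nat) (A : 'M[R]_n) : 'M[R]_n :=
  \matrix_(i, j) limn (fun N => \sum_(0 <= k < N)
     ((-1) ^+ k / ((2 * k).+1`!)%:R * (A ^+ (2 * k).+1) i j)).

Definition is_pinv (n : nat) (A X : 'M[R]_n) : Prop :=
  [/\ A *m X *m A = A, X *m A *m X = X,
      (A *m X)^T = A *m X & (X *m A)^T = X *m A].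
Definition pinv (n : nat) (A : 'M[R]_n) : 'M[R]_n :=
  match pselect (exists X, is_pinv A X) with
  | left h => projT1 (cid h)
  | right _ => 0
  end.

Definition eff_res (n : nat) (X : 'M[R]_n) (i j : 'I_n) : R :=
  pinv X i i + pinv X j j - 2 * pinv X i j.

Local Open Scope complex_scope.
Definition cmx (p q : nat) (A : 'M[R]_(p, q)) : 'M[R[i]]_(p, q) :=
  map_mx (fun x => x%:C) A.

(* transfer function at s = j omega:
   G(j w) = M_n (j w I + e^{-j w tau} L)^{-1} (-E) diag(sigma_e),
   with e^{-j w tau} = cos(w tau) - j sin(w tau) *)
Definition transfer (n m : nat) (L : 'M[R]_n) (E : 'M[R]_(n, m))
  (sigma : 'I_m -> R) (tau omega : R) : 'M[R[i]]_(n, m) :=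
  cmx (centering n) *m
  invmx ((0 +i* omega) *: 1%:M + (cos (omega * tau) -i* sin (omega * tau)) *: cmx L)
  *m cmx (- E *m diag_mx (\row_k sigma k)).

Definition rho_ss (n m : nat) (L : 'M[R]_n) (E : 'M[R]_(n, m))
  (tau : R) (s2 : 'I_m -> R) : R :=
  (2 * pi)^-1 * fine (\int[@lebesgue_measure R]_(omega in setT)
     (complex.Re (\tr ((map_mx conjc (transfer L E (fun k => Num.sqrt (s2 k)) tau omega))^T
               *m transfer L E (fun k => Num.sqrt (s2 k)) tau omega)))%:E).

End Defs.

(* Main.v *)
Require Import Defs.
From HB Require Import structures.
From mathcomp Require Import all_boot all_order all_algebra.
From mathcomp Require Import all_classical all_reals all_analysis.
From mathcomp Require Import complex sesquilinear spectral.
From mathcomp Require Import measurable_realfun ring lra.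
Set Implicit Arguments. Unset Strict Implicit. Unset Printing Implicit Defensive.
Import Order.TTheory GRing.Theory Num.Theory.
Import numFieldNormedType.Exports.
Local Open Scope ring_scope.
Local Open Scope classical_set_scope.

(**
The Laplacian is diagonalised as L = sum_l d_l q_l, and in each mode the noise
energy is (2 pi)^-1 times the integral over the real line of 1 / |D(i w)|^2,
where D(s) = s + lam e^{- tau s} and lam = d_l. So everything reduces to
  int 1 / |D(i w)|^2 dw = (pi / lam) cos(tau lam) / (1 - sin(tau lam)).

Let C(s) = (lam e^{- tau s} - s) / (lam e^{- tau s} + s). Since tau lam < pi / 2,
D has no zero in the closed right half-plane, so C is holomorphic there, and
Re C(i w) = (lam^2 - w^2) / |D(i w)|^2. Let Phi be the integral of Im C over the
semicircle i lam + r e^{i th}, |th| <= pi / 2, with respect to th. By the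
Cauchy-Riemann equations d Phi / dr = - (1 / r) [Re C] between the end points,
that is, Phi(r) - Phi(0) is the integral of (lam + w) / |D(i w)|^2 over
[lam - r, lam + r]. Here Phi(0) = pi Im C(i lam) = - pi cos / (1 - sin), and
Phi(r) tends to 0 as C tends to -1 at infinity. The odd part w / |D(i w)|^2
contributes nothing in the limit, which leaves lam times the wanted integral.
*)

(** * The integral of 1 / |i w + lam e^{- i tau w}|^2 *)

Section Derive.
Variable R : realType.
Implicit Types (f g : R -> R) (t : R).

Lemma is_derive_div f g t (df dg : R) : g t != 0 ->
  is_derive t 1 f df -> is_derive t 1 g dg ->
  is_derive t 1 (fun u => f u / g u) ((df * g t - f t * dg) / g t ^+ 2).
Proof.
move=> gt0 hf hg.
have hV := is_deriveV gt0 hg.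
apply: (is_derive_eq (is_deriveM hf hV)).
by rewrite /GRing.scale /=; field.
Qed.

(** By the fundamental theorem of calculus from base point [a]. The primitive stays abstract because
    later arguments use only its derivative. *)
Lemma primitive_exists (k : R -> R) (a : R) : continuous k ->
  exists K : R -> R, forall x : R, a < x -> is_derive x 1 K (k x).
Proof.
move=> ck; exists (fun x => \int[@lebesgue_measure R]_(t in `[a, x]) k t) => x ax.
have [] := @continuous_FTC1 R k (BLeft a) x (x + 1).
- by rewrite ltrDl.
- apply: continuous_compact_integrable; first exact: segment_compact.
  exact: continuous_subspaceT.
- by rewrite /= lte_fin.
- exact: ck.
by move=> h1 h2; apply: (DeriveDef h1); rewrite -derive1E; exact: h2.
Qed.

End Derive.

(** * Holomorphy of the Cayley transform C along paths *)

Section Cayley.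
Variables (R : realType) (lam tau : R).
Implicit Types (x y p q t : R).

(* With z = p - i q and s = x + i y, [cayQ] is |lam z + s|^2, the function
   (lam z - s) / (lam z + s) is [cayR] + i [cayI], and its derivative, computed
   with dz/ds = - tau z, is [cayDR] + i [cayDI]. *)
Definition cayQ x y p q : R := (lam * p + x) ^+ 2 + (y - lam * q) ^+ 2.
Definition cayR x y p q : R :=
  (lam ^+ 2 * (p ^+ 2 + q ^+ 2) - (x ^+ 2 + y ^+ 2)) / cayQ x y p q.
Definition cayI x y p q : R := - (2 * lam * (y * p + x * q)) / cayQ x y p q.
Definition cayDR x y p q : R :=
  - (2 * lam) * ((p * (1 + tau * x) + tau * q * y) *
                 ((lam * p + x) ^+ 2 - (y - lam * q) ^+ 2)
               + 2 * (lam * p + x) * (y - lam * q) *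
                 (tau * p * y - q * (1 + tau * x))) / cayQ x y p q ^+ 2.
Definition cayDI x y p q : R :=
  - (2 * lam) * ((tau * p * y - q * (1 + tau * x)) *
                 ((lam * p + x) ^+ 2 - (y - lam * q) ^+ 2)
               - 2 * (lam * p + x) * (y - lam * q) *
                 (p * (1 + tau * x) + tau * q * y)) / cayQ x y p q ^+ 2.

Variables (x y p q : R -> R) (t dx dy : R).
Hypothesis hx : is_derive t 1 x dx.
Hypothesis hy : is_derive t 1 y dy.
Hypothesis hp : is_derive t 1 p (- tau * (p t * dx + q t * dy)).
Hypothesis hq : is_derive t 1 q (- tau * (q t * dx - p t * dy)).
Hypothesis hQ : cayQ (x t) (y t) (p t) (q t) != 0.

Let hdQ : is_derive t 1 (fun u => cayQ (x u) (y u) (p u) (q u))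
  (2 * (lam * p t + x t) * (lam * (- tau * (p t * dx + q t * dy)) + dx)
   + 2 * (y t - lam * q t) * (dy - lam * (- tau * (q t * dx - p t * dy)))).
Proof.
have h1 := is_deriveX 2 (is_deriveD (is_deriveZ lam hp) hx).
have h2 := is_deriveX 2 (is_deriveB hy (is_deriveZ lam hq)).
apply: (is_derive_eq (is_deriveD h1 h2)).
rewrite !fctE /GRing.scale /= -[lam *: p t]/(lam * p t) -[lam *: q t]/(lam * q t).
ring.
Qed.

(** [hp] and [hq] encode dz = - tau z ds along the path. The value is the imaginary part of C'(s)
    (dx + i dy), and [is_derive_cayR] gives the real part; having both for all dx and dy amounts to
    the Cauchy-Riemann equations. *)
Lemma is_derive_cayI :
  is_derive t 1 (fun u => cayI (x u) (y u) (p u) (q u))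
    (cayDI (x t) (y t) (p t) (q t) * dx + cayDR (x t) (y t) (p t) (q t) * dy).
Proof.
have h1 : is_derive t 1 (fun u => - (2 * lam * (y u * p u + x u * q u)))
   (- (2 * lam * (y t * (- tau * (p t * dx + q t * dy)) + dy * p t +
                 (x t * (- tau * (q t * dx - p t * dy)) + dx * q t)))).
  have h := is_deriveD (is_deriveM hy hp) (is_deriveM hx hq).
  apply: (is_derive_eq (is_deriveN (is_deriveZ (2 * lam) h))).
  by rewrite /GRing.scale /=; ring.
have := @is_derive_div R _ (fun u => cayQ (x u) (y u) (p u) (q u)) t _ _ hQ h1 hdQ.
move/is_derive_eq; apply.
move: hQ; rewrite /cayDI /cayDR /cayQ => hQ'.
by field.
Qed.

Lemma is_derive_cayR :
  is_derive t 1 (fun u => cayR (x u) (y u) (p u) (q u))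
    (cayDR (x t) (y t) (p t) (q t) * dx - cayDI (x t) (y t) (p t) (q t) * dy).
Proof.
have h1 : is_derive t 1
   (fun u => lam ^+ 2 * (p u ^+ 2 + q u ^+ 2) - (x u ^+ 2 + y u ^+ 2))
   (lam ^+ 2 * (2 * p t * (- tau * (p t * dx + q t * dy))
                + 2 * q t * (- tau * (q t * dx - p t * dy)))
    - (2 * x t * dx + 2 * y t * dy)).
  have h := is_deriveB
    (is_deriveZ (lam ^+ 2) (is_deriveD (is_deriveX 2 hp) (is_deriveX 2 hq)))
    (is_deriveD (is_deriveX 2 hx) (is_deriveX 2 hy)).
  by apply: (is_derive_eq h); rewrite /GRing.scale /=; ring.
have := @is_derive_div R _ (fun u => cayQ (x u) (y u) (p u) (q u)) t _ _ hQ h1 hdQ.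
move/is_derive_eq; apply.
move: hQ; rewrite /cayDI /cayDR /cayQ => hQ'.
by field.
Qed.

End Cayley.

(** * Continuity of C and of its derivative *)

Section CayleyContinuity.
Variables (R : realType) (lam tau : R) (T : topologicalType).
Variables (x y p q : T -> R) (z : T).
Hypothesis cx : {for z, continuous x}.
Hypothesis cy : {for z, continuous y}.
Hypothesis cp : {for z, continuous p}.
Hypothesis cq : {for z, continuous q}.
Hypothesis hQ : cayQ lam (x z) (y z) (p z) (q z) != 0.

Let c0 (a : R) : (fun _ : T => a) u @[u --> z] --> a.
Proof. exact: cvg_cst. Qed.

Let cA : lam * p u + x u @[u --> z] --> lam * p z + x z.
Proof. by apply: cvgD; [apply: cvgM|]. Qed.

Let cB : y u - lam * q u @[u --> z] --> y z - lam * q z.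
Proof. by apply: cvgB; [|apply: cvgM]. Qed.

Let cQ : {for z, continuous (fun u => cayQ lam (x u) (y u) (p u) (q u))}.
Proof. by apply: cvgD; rewrite expr2; (under eq_fun do rewrite expr2); apply: cvgM. Qed.

Let c1 : p u * (1 + tau * x u) + tau * q u * y u @[u --> z] -->
  p z * (1 + tau * x z) + tau * q z * y z.
Proof.
apply: cvgD; apply: cvgM => //; first apply: cvgD => //; exact: cvgM.
Qed.

Let c2 : tau * p u * y u - q u * (1 + tau * x u) @[u --> z] -->
  tau * p z * y z - q z * (1 + tau * x z).
Proof.
apply: cvgB; apply: cvgM => //; first exact: cvgM.
by apply: cvgD => //; exact: cvgM.
Qed.

Let c3 : (lam * p u + x u) ^+ 2 - (y u - lam * q u) ^+ 2 @[u --> z] -->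
  (lam * p z + x z) ^+ 2 - (y z - lam * q z) ^+ 2.
Proof. by apply: cvgB; rewrite expr2; (under eq_fun do rewrite expr2); apply: cvgM. Qed.

Let c4 : 2 * (lam * p u + x u) * (y u - lam * q u) @[u --> z] -->
  2 * (lam * p z + x z) * (y z - lam * q z).
Proof. by apply: cvgM => //; apply: cvgM. Qed.

Let cQ2 : (cayQ lam (x u) (y u) (p u) (q u) ^+ 2)^-1 @[u --> z] -->
  (cayQ lam (x z) (y z) (p z) (q z) ^+ 2)^-1.
Proof.
apply: cvgV; first by rewrite expf_neq0.
by rewrite expr2; (under eq_fun do rewrite expr2); apply: cvgM.
Qed.

Lemma continuous_cayI :
  {for z, continuous (fun u => cayI lam (x u) (y u) (p u) (q u))}.
Proof.
apply: cvgM; last exact: cvgV.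
apply: cvgN; apply: cvgM => //; apply: cvgD; exact: cvgM.
Qed.

Lemma continuous_cayDR :
  {for z, continuous (fun u => cayDR lam tau (x u) (y u) (p u) (q u))}.
Proof.
apply: cvgM => //; apply: cvgM => //.
by apply: cvgD; apply: cvgM.
Qed.

Lemma continuous_cayDI :
  {for z, continuous (fun u => cayDI lam tau (x u) (y u) (p u) (q u))}.
Proof.
apply: cvgM => //; apply: cvgM => //.
by apply: cvgB; apply: cvgM.
Qed.

End CayleyContinuity.

(** * The characteristic function s + lam e^{- tau s} and its semicircle integral *)

Section Delay.
Variables (R : realType) (lam tau : R).
Hypotheses (lam0 : 0 < lam) (tau0 : 0 <= tau) (lamtau : tau * lam < pi / 2).
Implicit Types (x y t r th rho : R).

(* e^{- tau (x + i y)} = [dexpc x y] - i [dexps x y]. *)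
Definition dexpc x y : R := expR (- (tau * x)) * cos (tau * y).
Definition dexps x y : R := expR (- (tau * x)) * sin (tau * y).

Section Path.
Variables (x y : R -> R) (t dx dy : R).
Hypothesis hx : is_derive t 1 x dx.
Hypothesis hy : is_derive t 1 y dy.

Let he : is_derive t 1 (fun u => expR (- (tau * x u)))
  (expR (- (tau * x t)) * - (tau * dx)).
Proof.
exact: (is_derive1_comp (is_derive_expR _) (is_deriveN (is_deriveZ tau hx))).
Qed.

Lemma is_derive_dexpc : is_derive t 1 (fun u => dexpc (x u) (y u))
  (- tau * (dexpc (x t) (y t) * dx + dexps (x t) (y t) * dy)).
Proof.
have hc := @is_derive1_comp R cos (fun u => tau * y u) t _ _
  (is_derive_cos _) (is_deriveZ tau hy).
apply: (is_derive_eq (is_deriveM he hc)).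
by rewrite /dexpc /dexps /GRing.scale /=; ring.
Qed.

Lemma is_derive_dexps : is_derive t 1 (fun u => dexps (x u) (y u))
  (- tau * (dexps (x t) (y t) * dx - dexpc (x t) (y t) * dy)).
Proof.
have hc := @is_derive1_comp R sin (fun u => tau * y u) t _ _
  (is_derive_sin _) (is_deriveZ tau hy).
apply: (is_derive_eq (is_deriveM he hc)).
by rewrite /dexpc /dexps /GRing.scale /=; ring.
Qed.

End Path.

Lemma dexp_sqr_le1 x y : 0 <= x -> dexpc x y ^+ 2 + dexps x y ^+ 2 <= 1.
Proof.
move=> x0; rewrite !exprMn -mulrDr cos2Dsin2 mulr1 exprn_ile1 ?expR_ge0//.
by rewrite -expR0 ler_expR oppr_le0 mulr_ge0.
Qed.

(** At a zero, y = lam q, and |z| <= 1 in the right half-plane, so |y| <= lam. Then |tau y| <= tau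
    lam < pi / 2, the cosine is positive, and lam p + x > 0 contradicts the vanishing of the real
    part. *)
Lemma cayQ_gt0 x y : 0 <= x -> 0 < cayQ lam x y (dexpc x y) (dexps x y).
Proof.
move=> x0; rewrite lt_neqAle addr_ge0 ?sqr_ge0// andbT eq_sym.
rewrite paddr_eq0 ?sqr_ge0// !sqrf_eq0; apply/negP => /andP[/eqP A /eqP B].
have pq := dexp_sqr_le1 y x0.
have yl : `|y| <= lam.
  have -> : y = lam * dexps x y by lra.
  rewrite normrM gtr0_norm// ler_piMr ?(ltW lam0)//.
  move: pq; move: (dexpc x y) (dexps x y) => p q pq.
  by rewrite ler_norml; apply/andP; split; nra.
have : 0 < dexpc x y.
  rewrite mulr_gt0 ?expR_gt0// cos_gt0_pihalf// -ltr_norml normrM ger0_norm//.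
  by apply: le_lt_trans lamtau; rewrite ler_wpM2l.
move=> /(mulr_gt0 lam0); lra.
Qed.

(* The semicircle i lam + rho^2 e^{i th}, |th| <= pi / 2. Its radius is rho^2
   rather than rho so that it stays in the right half-plane for every real rho
   and differentiation at rho = 0 is two-sided. *)
Definition semi_x rho th : R := rho ^+ 2 * cos th.
Definition semi_y rho th : R := lam + rho ^+ 2 * sin th.

Definition semi (F : R -> R -> R -> R -> R) rho th : R :=
  F (semi_x rho th) (semi_y rho th)
    (dexpc (semi_x rho th) (semi_y rho th))
    (dexps (semi_x rho th) (semi_y rho th)).

(** The imaginary part of C'(s) e^{i th}, that is, the derivative of Im C with respect to the radius
    r = rho^2. *)
Definition semi_deriv rho th : R :=
  semi (cayDI lam tau) rho th * cos th + semi (cayDR lam tau) rho th * sin th.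

Lemma semiQ_neq0 rho th : 0 <= cos th -> semi (cayQ lam) rho th != 0.
Proof. by move=> th0; rewrite gt_eqF// cayQ_gt0// mulr_ge0 ?sqr_ge0. Qed.

Lemma is_derive_semi_cayI rho th : 0 <= cos th ->
  is_derive rho 1 (fun r => semi (cayI lam) r th) (2 * rho * semi_deriv rho th).
Proof.
move=> th0.
have h2 : is_derive rho 1 (fun r : R => r ^+ 2) (2 * rho).
  by apply: (is_derive_eq (is_deriveX 2 (is_derive_id rho 1))); rewrite /GRing.scale /=; ring.
have hx : is_derive rho 1 (fun r => semi_x r th) (2 * rho * cos th).
  apply: (is_derive_eq (is_deriveM h2 (is_derive_cst (cos th) rho 1))).
  by rewrite /GRing.scale /= ?fctE; ring.
have hy : is_derive rho 1 (fun r => semi_y r th) (2 * rho * sin th).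
  apply: (is_derive_eq (is_deriveD (is_derive_cst lam rho 1)
    (is_deriveM h2 (is_derive_cst (sin th) rho 1)))).
  by rewrite /GRing.scale /= ?fctE; ring.
have := is_derive_cayI hx hy (is_derive_dexpc hx hy) (is_derive_dexps hx hy)
  (semiQ_neq0 rho th0).
by move/is_derive_eq; apply; rewrite /semi_deriv /semi; ring.
Qed.

(* Together with [is_derive_semi_cayI], this is the Cauchy-Riemann equation in
   polar coordinates. *)
Lemma is_derive_semi_cayR rho th : 0 <= cos th ->
  is_derive th 1 (fun t => semi (cayR lam) rho t) (- rho ^+ 2 * semi_deriv rho th).
Proof.
move=> th0.
have hx : is_derive th 1 (fun t => semi_x rho t) (- (rho ^+ 2 * sin th)).
  apply: (is_derive_eq (is_deriveZ (rho ^+ 2) (is_derive_cos th))).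
  by rewrite /GRing.scale /= ; ring.
have hy : is_derive th 1 (fun t => semi_y rho t) (rho ^+ 2 * cos th).
  apply: (is_derive_eq (is_deriveD (is_derive_cst lam th 1)
    (is_deriveZ (rho ^+ 2) (is_derive_sin th)))).
  by rewrite /GRing.scale /= ; ring.
have := is_derive_cayR hx hy (is_derive_dexpc hx hy) (is_derive_dexps hx hy)
  (semiQ_neq0 rho th0).
by move/is_derive_eq; apply; rewrite /semi_deriv /semi; ring.
Qed.

Local Notation mu := (@lebesgue_measure R).
Local Notation halfpi := (`[- (pi / 2), pi / 2] : set R).

Let cos_halfpi th : halfpi th -> 0 <= cos th.
Proof. by rewrite /= in_itv/= => H; exact: cos_ge0_pihalf. Qed.

Lemma continuous_dexpc (T : topologicalType) (x y : T -> R) (z : T) :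
  {for z, continuous x} -> {for z, continuous y} ->
  {for z, continuous (fun u => dexpc (x u) (y u))}.
Proof.
move=> cx cy; apply: cvgM.
  apply: (@continuous_comp _ _ _ (fun u => - (tau * x u)) expR);
    last exact: continuous_expR.
  by apply: cvgN; apply: cvgM => //; exact: cvg_cst.
apply: (@continuous_comp _ _ _ (fun u => tau * y u) cos);
  last exact: continuous_cos.
by apply: cvgM => //; exact: cvg_cst.
Qed.

Lemma continuous_dexps (T : topologicalType) (x y : T -> R) (z : T) :
  {for z, continuous x} -> {for z, continuous y} ->
  {for z, continuous (fun u => dexps (x u) (y u))}.
Proof.
move=> cx cy; apply: cvgM.
  apply: (@continuous_comp _ _ _ (fun u => - (tau * x u)) expR);
    last exact: continuous_expR.
  by apply: cvgN; apply: cvgM => //; exact: cvg_cst.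
apply: (@continuous_comp _ _ _ (fun u => tau * y u) sin);
  last exact: continuous_sin.
by apply: cvgM => //; exact: cvg_cst.
Qed.

Section SemiContinuity.
Variables (T : topologicalType) (rho th : T -> R) (z : T).
Hypothesis crho : {for z, continuous rho}.
Hypothesis cth : {for z, continuous th}.
Hypothesis th0 : 0 <= cos (th z).

Let ccos : {for z, continuous (fun u => cos (th u))}.
Proof. by apply: (@continuous_comp _ _ _ th cos) => //; exact: continuous_cos. Qed.

Let csin : {for z, continuous (fun u => sin (th u))}.
Proof. by apply: (@continuous_comp _ _ _ th sin) => //; exact: continuous_sin. Qed.

Let csqr : {for z, continuous (fun u => rho u ^+ 2)}.
Proof.
by apply: (@continuous_comp _ _ _ rho (fun r => r ^+ 2)) => //; exact: exprn_continuous.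
Qed.

Let cx : {for z, continuous (fun u => semi_x (rho u) (th u))}.
Proof. exact: cvgM. Qed.

Let cy : {for z, continuous (fun u => semi_y (rho u) (th u))}.
Proof. by apply: cvgD; [exact: cvg_cst|exact: cvgM]. Qed.

Lemma continuous_semi_cayI :
  {for z, continuous (fun u => semi (cayI lam) (rho u) (th u))}.
Proof.
apply: continuous_cayI => //; [exact: continuous_dexpc|exact: continuous_dexps|].
exact: semiQ_neq0.
Qed.

(** The parameter space is arbitrary because continuity is used both in th alone and jointly in
    (rho, th). *)
Lemma continuous_semi_deriv :
  {for z, continuous (fun u => semi_deriv (rho u) (th u))}.
Proof.
have hI : {for z, continuous (fun u => semi (cayDI lam tau) (rho u) (th u))}.
  apply: continuous_cayDI => //; [exact: continuous_dexpc|exact: continuous_dexps|].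
  exact: semiQ_neq0.
have hR : {for z, continuous (fun u => semi (cayDR lam tau) (rho u) (th u))}.
  apply: continuous_cayDR => //; [exact: continuous_dexpc|exact: continuous_dexps|].
  exact: semiQ_neq0.
by apply: cvgD; apply: cvgM.
Qed.

End SemiContinuity.

(** Continuity on a compact rectangle yields the dominating constant for differentiating [Phi] under
    the integral sign. *)
Lemma semi_deriv_bounded a b : exists M : R, forall rho th,
  `[a, b] rho -> halfpi th -> `|2 * rho * semi_deriv rho th| <= M.
Proof.
pose f (z : R * R) := 2 * z.1 * semi_deriv z.1 z.2.
have cK : compact (`[a, b] `*` halfpi) by apply: compact_setX; exact: segment_compact.
have cf : {within (`[a, b] `*` halfpi), continuous f}.
  apply: continuous_in_subspaceT => z; rewrite inE => -[/= _ z2].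
  apply: cvgM; first by apply: cvgM; [exact: cvg_cst|exact: cvg_fst].
  apply: continuous_semi_deriv; [exact: cvg_fst|exact: cvg_snd|exact: cos_halfpi].
have := compact_bounded (continuous_compact cf cK).
move=> [M [Mr /(_ (M + 1))]]; rewrite ltrDl ltr01 => /(_ isT) H.
(* [compact_bounded] provides bounds only strictly above [M]. *)
exists (M + 1) => rho th hr ht.
by apply: (H (f (rho, th))); exists (rho, th).
Qed.

Definition Phi rho : R := \int[mu]_(th in halfpi) semi (cayI lam) rho th.

Let int_semi rho : mu.-integrable halfpi (EFin \o semi (cayI lam) rho).
Proof.
apply: continuous_compact_integrable; first exact: segment_compact.
apply: continuous_in_subspaceT => th; rewrite inE => /cos_halfpi th0.
by apply: (@continuous_semi_cayI _ (fun=> rho) id) => //; exact: cvg_cst.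
Qed.

Lemma is_derive_Phi_integral rho : is_derive rho 1 Phi
  (\int[mu]_(th in halfpi) (2 * rho * semi_deriv rho th)).
Proof.
(* The unit window around rho is an arbitrary neighbourhood on which the integrand's derivative is
   dominated. *)
have [M HM] := semi_deriv_bounded (rho - 1) (rho + 1).
have dE r th : halfpi th ->
    partial1of2 (semi (cayI lam)) r th = 2 * r * semi_deriv r th.
  move=> /cos_halfpi h; rewrite partial1of2E.
  by have := is_derive_semi_cayI r h => ?; rewrite derive_val.
have -> : \int[mu]_(th in halfpi) (2 * rho * semi_deriv rho th) =
    \int[mu]_(th in halfpi) partial1of2 (semi (cayI lam)) rho th.
  by apply: eq_Rintegral => th; rewrite inE => h; rewrite dE.
have a1 : (`]rho - 1, rho + 1[ : set R) rho.
  by rewrite /= in_itv/= ltrDl ltr01 gtrDl oppr_lt0 ltr01.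
have a2 r th : (`]rho - 1, rho + 1[ : set R) r -> halfpi th ->
    derivable ((semi (cayI lam))^~ th) r 1.
  move=> _ /cos_halfpi h; have := is_derive_semi_cayI r h => ?.
  exact: ex_derive.
have a3 : mu.-integrable halfpi (EFin \o (fun=> `|M|)).
  apply: continuous_compact_integrable; first exact: segment_compact.
  by apply: continuous_subspaceT => ?; exact: cvg_cst.
have a4 r th : (`]rho - 1, rho + 1[ : set R) r -> halfpi th ->
    `|partial1of2 (semi (cayI lam)) r th| <= `|M|.
  move=> hr hth; rewrite dE//; apply: le_trans (ler_norm M).
  by apply: HM => //; apply: subset_itv_oo_cc hr.
have H := @cvg_differentiation_under_integral R _ _ mu (semi (cayI lam)) halfpi
  (measurable_itv _) rho (rho - 1) (rho + 1) a1 (fun x _ => int_semi x) a2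
  (fun=> `|M|) (fun=> normr_ge0 M) a3 a4.
apply: DeriveDef.
  apply/cvg_ex; eexists; under eq_fun do rewrite scaler1; exact: H.
by rewrite -derive1E; apply/cvg_lim.
Qed.

(** By Cauchy-Riemann the radial derivative is an exact th-derivative, so only the end points of the
    semicircle remain. The factor - 2 / rho is 2 rho divided by - rho^2. *)
Lemma Rintegral_semi_deriv rho : rho != 0 ->
  \int[mu]_(th in halfpi) (2 * rho * semi_deriv rho th) =
  - (2 / rho) * (semi (cayR lam) rho (pi / 2) - semi (cayR lam) rho (- (pi / 2))).
Proof.
move=> r0.
pose F th := - (2 / rho) * semi (cayR lam) rho th.
have hF th : 0 <= cos th -> is_derive th 1 F (2 * rho * semi_deriv rho th).
  move=> th0; apply: (is_derive_eq (is_deriveZ (- (2 / rho)) (is_derive_semi_cayR rho th0))).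
  by rewrite /GRing.scale /=; field.
have cF th : 0 <= cos th -> {for th, continuous F}.
  move=> /hF h; apply: differentiable_continuous; apply/derivable1_diffP.
  exact: ex_derive.
have pi0 : 0 < pi / 2 :> R by rewrite divr_gt0 ?pi_gt0.
rewrite /Rintegral (@continuous_FTC2 _ _ F).
- by rewrite -EFinB /= /F; ring.
- by lra.
- apply: continuous_in_subspaceT => th; rewrite inE => /cos_halfpi th0.
  apply: cvgM; first exact: cvg_cst.
  by apply: (@continuous_semi_deriv _ (fun=> rho) id) => //; exact: cvg_cst.
- split.
  + move=> th hth; have h : 0 <= cos th.
      by apply: cos_halfpi; exact: subset_itv_oo_cc hth.
    by have := hF _ h => ?; exact: ex_derive.
  + by apply: cvg_at_right_filter; apply: cF; rewrite cosN cos_pihalf.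
  + by apply: cvg_at_left_filter; apply: cF; rewrite cos_pihalf.
- move=> th hth; have h : 0 <= cos th.
    by apply: cos_halfpi; exact: subset_itv_oo_cc hth.
  by have := hF _ h => ?; rewrite derive1E derive_val.
Qed.

(* The squared modulus of lam e^{-i tau w} + i w. *)
Definition delay_den (w : R) : R := lam ^+ 2 + w ^+ 2 - 2 * lam * w * sin (tau * w).

Implicit Types w : R.

Lemma cayQ_axis w : cayQ lam 0 w (dexpc 0 w) (dexps 0 w) = delay_den w.
Proof.
rewrite /cayQ /dexpc /dexps /delay_den mulr0 oppr0 expR0 !mul1r addr0.
have := cos2Dsin2 (tau * w); set c := cos _; set s := sin _ => cs.
have -> : (lam * c) ^+ 2 = lam ^+ 2 * (1 - s ^+ 2) by rewrite -cs addrK exprMn.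
ring.
Qed.

Lemma delay_den_gt0 w : 0 < delay_den w.
Proof. by rewrite -cayQ_axis cayQ_gt0. Qed.

Lemma delay_denN w : delay_den (- w) = delay_den w.
Proof. by rewrite /delay_den (mulrN tau) sinN; ring. Qed.

Lemma cayR_axis w :
  cayR lam 0 w (dexpc 0 w) (dexps 0 w) = (lam ^+ 2 - w ^+ 2) / delay_den w.
Proof.
rewrite /cayR cayQ_axis; congr (_ / _).
rewrite /dexpc /dexps mulr0 oppr0 expR0 !mul1r cos2Dsin2; ring.
Qed.

(** The end points lie on the imaginary axis at w = lam + rho^2 and w = lam - rho^2. There lam^2 -
    w^2 = (lam - w)(lam + w) has a factor rho^2, which absorbs the 1 / rho of
    [Rintegral_semi_deriv]. *)
Lemma is_derive_Phi rho : is_derive rho 1 Phi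
  (2 * rho * ((2 * lam + rho ^+ 2) / delay_den (lam + rho ^+ 2) +
              (2 * lam - rho ^+ 2) / delay_den (lam - rho ^+ 2))).
Proof.
apply: is_derive_eq (is_derive_Phi_integral rho) _.
(* The end-point formula divides by rho; at rho = 0 both sides vanish. *)
have [->|r0] := eqVneq rho 0.
  rewrite !(mulr0, mul0r); under eq_Rintegral do rewrite mul0r.
  by rewrite Rintegral_cst// mul0r.
rewrite Rintegral_semi_deriv// /semi /semi_x /semi_y sinN cosN sin_pihalf.
rewrite cos_pihalf mulr0 mulr1 mulrN1 !cayR_axis.
have := delay_den_gt0 (lam + rho ^+ 2); have := delay_den_gt0 (lam - rho ^+ 2).
move: (delay_den _) (delay_den _) => a b a0 b0.
by field; rewrite r0 !gt_eqF.
Qed.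

(** With w = lam + rho^2 and w = lam - rho^2, the chain rule gives the right-hand side the same
    rho-derivative as [Phi]; the difference [f] is therefore constant by the mean value theorem. *)
Lemma Phi_increment r (K : R -> R) : 0 <= r ->
  (forall w, lam - r <= w -> is_derive w 1 K ((lam + w) / delay_den w)) ->
  Phi (Num.sqrt r) - Phi 0 = K (lam + r) - K (lam - r).
Proof.
move=> r0 hK.
pose f rho := Phi rho - (K (lam + rho ^+ 2) - K (lam - rho ^+ 2)).
have hf rho : rho \in `[0, Num.sqrt r]%R -> is_derive rho 1 f 0.
  rewrite in_itv/= => /andP[rho0 rhor].
  have rr : rho ^+ 2 <= r.
    by rewrite -(sqr_sqrtr r0) ler_sqr ?nnegrE ?sqrtr_ge0.
  have rho2 : 0 <= rho ^+ 2 by exact: sqr_ge0.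
  have h2 : is_derive rho 1 (fun r : R => r ^+ 2) (2 * rho).
    apply: (is_derive_eq (is_deriveX 2 (is_derive_id rho 1))).
    by rewrite /GRing.scale /=; ring.
  have hp : is_derive rho 1 (fun r : R => lam + r ^+ 2) (2 * rho).
    by apply: (is_derive_eq (is_deriveD (is_derive_cst lam rho 1) h2)); rewrite add0r.
  have hm : is_derive rho 1 (fun r : R => lam - r ^+ 2) (- (2 * rho)).
    by apply: (is_derive_eq (is_deriveB (is_derive_cst lam rho 1) h2)); rewrite sub0r.
  have Kp : is_derive (lam + rho ^+ 2) 1 K
      ((lam + (lam + rho ^+ 2)) / delay_den (lam + rho ^+ 2)).
    by apply: hK; lra.
  have Km : is_derive (lam - rho ^+ 2) 1 K
      ((lam + (lam - rho ^+ 2)) / delay_den (lam - rho ^+ 2)).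
    by apply: hK; lra.
  have h := is_deriveB (is_derive_Phi rho) (is_deriveB
    (@is_derive1_comp _ K (fun r : R => lam + r ^+ 2) rho _ _ Kp hp)
    (@is_derive1_comp _ K (fun r : R => lam - r ^+ 2) rho _ _ Km hm)).
  by apply: (is_derive_eq h); ring.
have h1 x : x \in `]0, Num.sqrt r[%R -> is_derive x 1 f ((fun=> 0) x).
  by move=> hx; apply: hf; exact: subset_itv_oo_cc hx.
have h2 : {within `[0, Num.sqrt r], continuous f}.
  by apply: derivable_within_continuous => x /hf h; exact: ex_derive.
have [c _] := MVT_segment (sqrtr_ge0 r) h1 h2.
rewrite mul0r /f sqr_sqrtr// expr0n /= addr0 subr0.
lra.
Qed.

(** * Growth estimates and passage to the whole line *)

Lemma continuous_delay_den : continuous delay_den.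
Proof.
have -> : delay_den = fun w => (lam ^+ 2 + w * w) - (2 * lam * w) * sin (tau * w).
  by apply/funext => w; rewrite /delay_den expr2.
have cl : continuous (fun w : R => tau * w).
  by move=> w; apply: cvgM; [exact: cvg_cst|exact: cvg_id].
have cs : continuous (fun w : R => sin (tau * w)).
  by move=> w; apply: continuous_comp; [exact: cl|exact: continuous_sin].
move=> w; apply: cvgB.
  by apply: cvgD; [exact: cvg_cst|apply: cvgM; exact: cvg_id].
apply: cvgM; last exact: cs.
by apply: cvgM; [exact: cvg_cst|exact: cvg_id].
Qed.

Lemma continuous_delay_denV : continuous (fun w => (delay_den w)^-1).
Proof.
move=> w; apply: cvgV; first by rewrite gt_eqF// delay_den_gt0.
exact: continuous_delay_den.
Qed.

(** Since the sine is at most 1, the denominator is at least (w - lam)^2, and w - lam >= w / 2. *)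
Lemma delay_den_ge w : 2 * lam <= w -> w ^+ 2 / 4 <= delay_den w.
Proof.
move=> hw; rewrite /delay_den.
have := sin_le1 (tau * w); set s := sin _ => s1.
have l0 := lam0.
have l2 : 0 <= 2 * lam by lra.
have w0 : 0 <= w by lra.
have s0 : 0 <= 1 - s by lra.
have := mulr_ge0 (mulr_ge0 l2 w0) s0.
have := sqr_ge0 (w - 2 * lam).
nra.
Qed.

(** Write r = rho^2. The numerator is at most 2 lam times 4 (r - lam), and the denominator is at
    least (r - lam)^2 / 4; hence the constant 32. *)
Lemma semi_cayI_le rho th : 3 * lam <= rho ^+ 2 -> 0 <= cos th ->
  `|semi (cayI lam) rho th| <= 32 * lam / (rho ^+ 2 - lam).
Proof.
move=> hr th0; have l0 := lam0; rewrite /semi /cayI.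
set x := semi_x rho th; set y := semi_y rho th.
have x0 : 0 <= x by rewrite mulr_ge0 ?sqr_ge0.
have pq := dexp_sqr_le1 y x0; have Q0 := cayQ_gt0 y x0.
have cs := cos2Dsin2 th.
have xE : x = rho ^+ 2 * cos th by [].
have yE : y = lam + rho ^+ 2 * sin th by [].
move: (cos th) (sin th) th0 cs xE yE => c s c0 cs xE yE.
move: (dexpc x y) (dexps x y) pq Q0 => p q pq Q0.
move: (rho ^+ 2) hr xE yE => r hr xE yE.
move: x y x0 Q0 xE yE => x y x0 Q0 xE yE.
(* Reverse triangle inequality for s = i lam + r e^{i th}. *)
have S : (r - lam) ^+ 2 <= x ^+ 2 + y ^+ 2.
  have -> : x ^+ 2 + y ^+ 2 = r ^+ 2 * (c ^+ 2 + s ^+ 2) + 2 * lam * r * s + lam ^+ 2.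
    by rewrite xE yE; ring.
  rewrite cs; have s1 : -1 <= s by nra.
  have l2 : 0 <= 2 * lam by lra.
  have r0 : 0 <= r by lra.
  have s0 : 0 <= 1 + s by lra.
  have := mulr_ge0 (mulr_ge0 l2 r0) s0.
  nra.
have Q1 : (x ^+ 2 + y ^+ 2) / 4 <= cayQ lam x y p q.
  (* Half of |2 lam z + s|^2 equals |lam z + s|^2 + lam^2 |z|^2 - |s|^2 / 2, so |lam z + s|^2 >=
     |s|^2 / 2 - lam^2; and lam^2 <= |s|^2 / 4 by [h3]. *)
  have h1 : 0 <= (2 * (lam * p) + x) ^+ 2 + (y - 2 * (lam * q)) ^+ 2.
    by rewrite addr_ge0 ?sqr_ge0.
  have h2 : lam ^+ 2 * (p ^+ 2 + q ^+ 2) <= lam ^+ 2.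
    by rewrite ler_piMr ?sqr_ge0.
  have h3 : 4 * lam ^+ 2 <= x ^+ 2 + y ^+ 2 by apply: le_trans S; nra.
  rewrite /cayQ; nra.
have N1 : `|y * p + x * q| <= 4 * (r - lam).
  have p1 : `|p| <= 1 by rewrite ler_norml; apply/andP; split; nra.
  have q1 : `|q| <= 1 by rewrite ler_norml; apply/andP; split; nra.
  have s1 : `|s| <= 1 by rewrite ler_norml; apply/andP; split; nra.
  have c1 : `|c| <= 1 by rewrite ler_norml; apply/andP; split; nra.
  have r0 : 0 <= r by lra.
  have xr : `|x| <= r by rewrite xE normrM (ger0_norm r0) ler_piMr.
  have yr : `|y| <= lam + r.
    rewrite yE (le_trans (ler_normD _ _))// gtr0_norm// lerD2l normrM (ger0_norm r0).
    by rewrite ler_piMr.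
  apply: le_trans (ler_normD _ _) _; rewrite !normrM.
  have : `|y| * `|p| <= lam + r by apply: le_trans yr; rewrite ler_piMr.
  have : `|x| * `|q| <= r by apply: le_trans xr; rewrite ler_piMr.
  lra.
rewrite mulNr normrN normrM normfV (gtr0_norm Q0) normrM.
have l2 : 0 < 2 * lam by lra.
rewrite (gtr0_norm l2) ler_pdivrMr//.
have rl : 0 < r - lam by lra.
have Q2 : (r - lam) ^+ 2 / 4 <= cayQ lam x y p q by lra.
have -> : 32 * lam / (r - lam) * cayQ lam x y p q =
    2 * lam * (16 * (cayQ lam x y p q / (r - lam))).
  by field; rewrite gt_eqF.
rewrite ler_pM2l//; apply: le_trans N1 _.
rewrite mulrA ler_pdivlMr//; nra.
Qed.

Lemma Phi_le r : 3 * lam <= r -> `|Phi (Num.sqrt r)| <= 32 * pi * lam / (r - lam).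
Proof.
move=> hr; have l0 := lam0; have r0 : 0 <= r by lra.
have p0 : 0 < pi :> R := pi_gt0 R.
have ic : mu.-integrable halfpi (EFin \o (fun=> 32 * lam / (r - lam))).
  apply: continuous_compact_integrable; first exact: segment_compact.
  by apply: continuous_subspaceT => ?; exact: cvg_cst.
apply: le_trans (le_normr_Rintegral _ (int_semi _)) _ => //.
have -> : 32 * pi * lam / (r - lam) = \int[mu]_(th in halfpi) (32 * lam / (r - lam)).
  rewrite Rintegral_cst//= lebesgue_measure_itv/= lte_fin ifT; last by lra.
  by rewrite -EFinB/=; field; rewrite gt_eqF//; lra.
apply: le_Rintegral => //.
  exact: integrable_norm (int_semi _).
move=> th /cos_halfpi th0; have := @semi_cayI_le (Num.sqrt r) th.
by rewrite sqr_sqrtr//; apply.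
Qed.

(** This is - Im C(i lam). *)
Definition delay_gain : R := cos (tau * lam) / (1 - sin (tau * lam)).

Lemma Phi0 : Phi 0 = - (pi * delay_gain).
Proof.
have l0 := lam0.
have := delay_den_gt0 lam; rewrite /delay_den => d0.
(* [delay_den lam] equals 2 lam^2 (1 - sin (tau lam)), so a sine equal to 1 would make it vanish. *)
have s1 : 1 - sin (tau * lam) != 0.
  apply/eqP => s1; move: d0; have -> : sin (tau * lam) = 1 by lra.
  by rewrite mulr1; nra.
have vE th : semi (cayI lam) 0 th = - delay_gain.
  rewrite /semi /semi_x /semi_y expr0n /= !mul0r addr0 /cayI cayQ_axis.
  rewrite /dexpc /dexps mulr0 oppr0 expR0 !mul1r mul0r addr0 /delay_den /delay_gain.
  by field; rewrite s1 !gt_eqF.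
rewrite /Phi; under eq_Rintegral do rewrite vE.
have p0 : 0 < pi :> R := pi_gt0 R.
rewrite Rintegral_cst//= lebesgue_measure_itv/= lte_fin ifT; last by lra.
by rewrite -EFinB/=; field.
Qed.

(** [H] has an odd derivative, so H(lam - r) = H(r - lam). What remains is the increment over
    [r - lam, r + lam], of length 2 lam, where w / [delay_den w] <= 4 / w <= 4 / (r - lam). *)
Let even_increment r (H : R -> R) : 3 * lam <= r ->
  (forall w, lam - r <= w -> is_derive w 1 H (w / delay_den w)) ->
  `|H (lam + r) - H (lam - r)| <= 8 * lam / (r - lam).
Proof.
move=> hr hH; have l0 := lam0.
pose h w := H w - H (- w).
have hh w : w \in `[0, r - lam]%R -> is_derive w 1 h 0.
  rewrite in_itv/= => /andP[w0 wr].
  have h1 : is_derive w 1 H (w / delay_den w) by apply: hH; lra.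
  have h2 : is_derive (- w) 1 H (- w / delay_den (- w)) by apply: hH; lra.
  have h3 := is_deriveB h1 (@is_derive1_comp _ H -%R w _ _ h2 (is_deriveNid w 1)).
  by apply: (is_derive_eq h3); rewrite delay_denN; ring.
have rl : 0 <= r - lam by lra.
have h1 x : x \in `]0, r - lam[%R -> is_derive x 1 h ((fun=> 0) x).
  by move=> hx; apply: hh; exact: subset_itv_oo_cc hx.
have h2 : {within `[0, r - lam], continuous h}.
  by apply: derivable_within_continuous => x /hh ?; exact: ex_derive.
have [c _] := MVT_segment rl h1 h2.
rewrite mul0r /h oppr0 subrr subr0 opprB => /eqP; rewrite subr_eq0 => /eqP <-.
have rr : r - lam <= lam + r by lra.
have h3 x : x \in `]r - lam, lam + r[%R -> is_derive x 1 H ((fun w => w / delay_den w) x).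
  by rewrite in_itv/= => /andP[x1 x2]; apply: hH; lra.
have h4 : {within `[r - lam, lam + r], continuous H}.
  apply: derivable_within_continuous => x; rewrite in_itv/= => /andP[x1 x2].
  have : is_derive x 1 H (x / delay_den x) by apply: hH; lra.
  by move=> ?; exact: ex_derive.
have [w] := MVT_segment rr h3 h4.
rewrite in_itv/= => /andP[w1 w2] ->.
have w0 : 0 < w by lra.
have d0 := delay_den_gt0 w.
have d1 : w ^+ 2 / 4 <= delay_den w by apply: delay_den_ge; lra.
have -> : lam + r - (r - lam) = 2 * lam by ring.
rewrite ger0_norm; last by rewrite mulr_ge0 ?divr_ge0// ?ltW//; lra.
have -> : 8 * lam / (r - lam) = 4 / (r - lam) * (2 * lam) by field; rewrite gt_eqF//; lra.
rewrite ler_pM2r; last by lra.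
rewrite ler_pdivrMr// mulrAC ler_pdivlMr; last by lra.
nra.
Qed.

Lemma delay_integral_truncated r : 3 * lam <= r ->
  `|lam * \int[mu]_(w in `[lam - r, lam + r]) (delay_den w)^-1 - pi * delay_gain|
  <= (32 * pi + 8) * lam / (r - lam).
Proof.
move=> hr; have l0 := lam0.
(* Starting one unit left of lam - r makes the derivative two-sided at lam - r itself. *)
have [G hG] := @primitive_exists R (fun w => (delay_den w)^-1) (lam - r - 1)
  continuous_delay_denV.
have cw : continuous (fun w => w / delay_den w).
  by move=> w; apply: cvgM; [exact: cvg_id|exact: continuous_delay_denV].
have [H hH] := @primitive_exists R (fun w => w / delay_den w) (lam - r - 1) cw.
have {}hG w : lam - r <= w -> is_derive w 1 G (delay_den w)^-1.
  by move=> ?; apply: hG; lra.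
have {}hH w : lam - r <= w -> is_derive w 1 H (w / delay_den w).
  by move=> ?; apply: hH; lra.
have -> : \int[mu]_(w in `[lam - r, lam + r]) (delay_den w)^-1
    = G (lam + r) - G (lam - r).
  have cG w : lam - r <= w -> {for w, continuous G}.
    move=> /hG h; apply: differentiable_continuous; apply/derivable1_diffP.
    exact: ex_derive.
  rewrite /Rintegral (@continuous_FTC2 _ _ G)//.
  - by lra.
  - by apply: continuous_subspaceT; exact: continuous_delay_denV.
  - split.
    + move=> w; rewrite in_itv/= => /andP[/ltW w1 _].
      by have := hG _ w1 => ?; exact: ex_derive.
    + by apply: cvg_at_right_filter; apply: cG.
    + by apply: cvg_at_left_filter; apply: cG; lra.
  - move=> w; rewrite in_itv/= => /andP[/ltW w1 _].
    by have := hG _ w1 => ?; rewrite derive1E derive_val.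
have hK w : lam - r <= w ->
    is_derive w 1 (fun w => lam * G w + H w) ((lam + w) / delay_den w).
  move=> hw; apply: (is_derive_eq (is_deriveD (is_deriveZ lam (hG w hw)) (hH w hw))).
  by rewrite /GRing.scale /=; ring.
have r0 : 0 <= r by lra.
have := Phi_increment r0 hK; rewrite Phi0 /=.
have := even_increment hr hH; have := Phi_le hr.
have -> : 32 * pi * lam / (r - lam) = (32 * pi + 8) * lam / (r - lam) - 8 * lam / (r - lam).
  by field; rewrite gt_eqF//; lra.
move: (8 * lam / (r - lam)) ((32 * pi + 8) * lam / (r - lam)) (Phi _) => a b P.
rewrite !ler_norml => /andP[? ?] /andP[? ?] E; apply/andP; split; lra.
Qed.

(** Monotone convergence along the intervals [lam - n, lam + n] needs only positivity; the truncated
    estimate then identifies the limit. *)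
Lemma integral_delay_denV :
  (\int[mu]_w ((delay_den w)^-1)%:E = (pi / lam * delay_gain)%:E)%E.
Proof.
have l0 := lam0.
pose A (n : nat) := `[lam - n%:R, lam + n%:R] : set R.
have AT : \bigcup_n A n = setT.
  apply/seteqP; split => // w _; exists (Num.truncn `|w - lam|).+1 => //=.
  rewrite /A/= in_itv/=; have := truncnS_gt `|w - lam|.
  by rewrite ltr_norml => /andP[? ?]; apply/andP; split; lra.
have : (\int[mu]_(w in A n) ((delay_den w)^-1)%:E)%E @[n --> \oo] -->
    (\int[mu]_w ((delay_den w)^-1)%:E)%E.
  rewrite -AT; apply: ge0_nondecreasing_set_cvg_integral.
  - move=> n m nm; apply/subsetPset => w; rewrite /A /= !in_itv/= => /andP[? ?].
    have : n%:R <= m%:R :> R by rewrite ler_nat.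
    by move=> ?; apply/andP; split; lra.
  - by move=> n; exact: measurable_itv.
  - move=> n; apply/measurable_EFinP; apply: measurable_funTS.
    by apply: continuous_measurable_fun; exact: continuous_delay_denV.
  - by move=> n w _; rewrite lee_fin invr_ge0 ltW// delay_den_gt0.
have iA n : mu.-integrable (A n) (EFin \o (fun w => (delay_den w)^-1)).
  apply: continuous_compact_integrable; first exact: segment_compact.
  by apply: continuous_subspaceT; exact: continuous_delay_denV.
have EA n : (\int[mu]_(w in A n) ((delay_den w)^-1)%:E)%E =
    (\int[mu]_(w in A n) (delay_den w)^-1)%:E.
  rewrite /Rintegral fineK//; apply: integrable_fin_num; last exact: iA.
  exact: measurable_itv.
under eq_fun do rewrite EA.
move=> h1.
suff h2 : (\int[mu]_(w in A n) (delay_den w)^-1)%:E @[n --> \oo] -->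
    (pi / lam * delay_gain)%:E.
  exact: cvg_unique h1 h2.
apply: cvg_EFin; first by near=> n.
apply/cvgrPdist_le => e e0; near=> n.
rewrite distrC -(ler_pM2l lam0) -{1}(gtr0_norm lam0) -normrM mulrBr.
have -> : lam * (pi / lam * delay_gain) = pi * delay_gain.
  by field; rewrite gt_eqF.
apply: le_trans (delay_integral_truncated _) _.
  by near: n; exact: nbhs_infty_ger.
rewrite ler_pdivrMr; last first.
  by rewrite subr_gt0; near: n; exact: nbhs_infty_gtr.
rewrite (mulrC _ lam) -mulrA ler_pM2l// -ler_pdivrMl// lerBrDr.
by near: n; exact: nbhs_infty_ger.
Unshelve. all: end_near. Qed.

End Delay.

(** * Functional calculus of real symmetric matrices *)

Section Cmx.
Variable R : realType.
Local Open Scope complex_scope.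

Lemma cmxM p q r (A : 'M[R]_(p, q)) (B : 'M[R]_(q, r)) :
  cmx (A *m B) = cmx A *m cmx B.
Proof. exact: (map_mxM (real_complex R)). Qed.

Lemma cmxD p q (A B : 'M[R]_(p, q)) : cmx (A + B) = cmx A + cmx B.
Proof. exact: (map_mxD (real_complex R)). Qed.

Lemma cmxB p q (A B : 'M[R]_(p, q)) : cmx (A - B) = cmx A - cmx B.
Proof. exact: (map_mxB (real_complex R)). Qed.

Lemma cmx1 p : cmx (1%:M : 'M[R]_p) = 1%:M.
Proof. exact: (map_mx1 (real_complex R)). Qed.

Lemma cmx_tr p q (A : 'M[R]_(p, q)) : cmx A^T = (cmx A)^T.
Proof. by apply/matrixP => i j; rewrite !mxE. Qed.

Lemma cmx_inj p q : injective (@cmx R p q).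
Proof.
move=> A B /matrixP AB; apply/matrixP => i j.
by have := AB i j; rewrite !mxE => -[].
Qed.

Lemma conj_cmx p q (A : 'M[R]_(p, q)) : map_mx conjc (cmx A) = cmx A.
Proof. by apply/matrixP => i j; rewrite !mxE /= oppr0. Qed.

Lemma cmx_Re p q (A : 'M[R[i]]_(p, q)) :
  map_mx conjc A = A -> cmx (map_mx (@complex.Re R) A) = A.
Proof.
move=> /matrixP h; apply/matrixP => i j; have := h i j; rewrite !mxE.
case: (A i j) => a b [] /= /eqP; rewrite -subr_eq0 -opprD oppr_eq0 -mulr2n.
by rewrite mulrn_eq0 /= => /eqP ->.
Qed.

End Cmx.

(** This plays the role of f(A) for A = sum_l d_l q_l. Multiplicativity is asked of whole sums only:
    below, [q l] is the real part of a complex rank-one projection and need not be a projection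
    itself. *)
Definition spec_fun (R : realType) (n : nat) (d : 'I_n -> R) (q : 'I_n -> 'M[R]_n)
  (f : R -> R) : 'M[R]_n := \sum_l f (d l) *: q l.

(** * Spectral theorem for real symmetric matrices, through the complex one *)

Section SpectralCalculus.
Variables (R : realType) (n : nat).
Implicit Types (A P : 'M[R]_n).
Local Open Scope complex_scope.

Lemma conj_mxK p q (M : 'M[R[i]]_(p, q)) : map_mx conjc (map_mx conjc M) = M.
Proof. by apply/matrixP => i j; rewrite !mxE conjcK. Qed.

Lemma symmetric_unitary_diag (A : 'M[R]_n) : A^T = A ->
  exists (P : 'M[R[i]]_n) (d : 'I_n -> R),
    [/\ P *m (map_mx conjc P)^T = 1%:M &
        cmx A = (map_mx conjc P)^T *m diag_mx (\row_l (d l)%:C) *m P].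
Proof.
move=> Asym.
have herm : cmx A \is hermsymmx.
  apply: realsym_hermsym.
    by apply/is_hermitianmxP; rewrite expr0 scale1r map_mx_id// -cmx_tr Asym.
  by apply/mxOverP => i j; rewrite mxE complex_real.
have invP : invmx (spectralmx (cmx A)) = (map_mx conjc (spectralmx (cmx A)))^T.
  rewrite invmx_unitary ?spectral_unitarymx//.
  by apply/matrixP => i j; rewrite !mxE.
exists (spectralmx (cmx A)), (fun l => complex.Re (spectral_diag (cmx A) 0 l)).
split; first by rewrite -invP mulmxV// spectral_unit.
have /hermitian_normalmx/orthomx_spectralP := herm; rewrite invP => {1}->.
congr (_ *m diag_mx _ *m _); apply/rowP => l; rewrite mxE RRe_real//.
by have /mxOverP/(_ 0 l) := hermitian_spectral_diag_real herm.
Qed.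

(** A nonzero entry U_ij forces d_i = d_j, hence f(d_i) = f(d_j). *)
Lemma diag_comm_fun (U : 'M[R[i]]_n) (d : 'I_n -> R) (f : R -> R) :
  U *m diag_mx (\row_l (d l)%:C) = diag_mx (\row_l (d l)%:C) *m U ->
  U *m diag_mx (\row_l (f (d l))%:C) = diag_mx (\row_l (f (d l))%:C) *m U.
Proof.
rewrite !mul_mx_diag !mul_diag_mx => /matrixP h; apply/matrixP => i j.
move: (h i j); rewrite !mxE.
have [->|Uij] := eqVneq (U i j) 0; first by rewrite !mulr0 !mul0r.
by rewrite mulrC => /(mulIf Uij) [] ->; rewrite mulrC.
Qed.

Section Diag.
Variables (P : 'M[R[i]]_n) (d : 'I_n -> R).
Let Ph := (map_mx conjc P)^T.
Hypothesis PPh : P *m Ph = 1%:M.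
Let S (f : 'I_n -> R[i]) : 'M[R[i]]_n := Ph *m diag_mx (\row_l f l) *m P.

Let SM f g : S f *m S g = S (fun l => f l * g l).
Proof.
rewrite /S !mulmxA -(mulmxA _ P) PPh mulmx1 -(mulmxA Ph) mulmx_diag.
by congr (_ *m diag_mx _ *m _); apply/rowP => l; rewrite !mxE.
Qed.

Let S1 : S (fun=> 1) = 1%:M.
Proof.
have -> : S (fun=> 1) = Ph *m P.
  rewrite /S; have -> : \row_l 1 = const_mx 1 :> 'rV[R[i]]_n by apply/rowP => l; rewrite !mxE.
  by rewrite diag_const_mx mulmx1.
exact: mulmx1C.
Qed.

(* [conj P *m Ph] commutes with [diag d], hence with [diag (f \o d)]. *)
Let S_real (f : R -> R) : map_mx conjc (S (fun l => (d l)%:C)) = S (fun l => (d l)%:C) ->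
  map_mx conjc (S (fun l => (f (d l))%:C)) = S (fun l => (f (d l))%:C).
Proof.
pose D (g : R -> R) : 'M[R[i]]_n := diag_mx (\row_l (g (d l))%:C).
have conjS g : map_mx conjc (S (fun l => (g (d l))%:C)) =
    P^T *m D g *m map_mx conjc P.
  rewrite /S !map_mxM /Ph map_trmx conj_mxK map_diag_mx.
  congr (_ *m diag_mx _ *m _).
  by apply/rowP => l; rewrite !mxE /= oppr0.
pose U := map_mx conjc P *m Ph.
have PhP : Ph *m P = 1%:M by exact: mulmx1C.
have cPP : map_mx conjc P *m P^T = 1%:M.
  by have := congr1 (map_mx conjc) PPh; rewrite map_mxM /Ph map_trmx conj_mxK map_mx1.
have PcP : P^T *m map_mx conjc P = 1%:M by exact: mulmx1C.
move=> h.
have UD : U *m D id = D id *m U.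
  move: h; rewrite (conjS id) /S -/(D id) => h; rewrite /U mulmxA.
  have := congr1 (fun X => map_mx conjc P *m X *m Ph) h.
  by rewrite !mulmxA cPP mul1mx -!mulmxA PPh mulmx1 !mulmxA => ->.
have UDf : U *m D f = D f *m U.
  exact: diag_comm_fun UD.
rewrite (conjS f) /S -/(D f).
have -> : map_mx conjc P = U *m P by rewrite /U -mulmxA PhP mulmx1.
by rewrite -mulmxA (mulmxA (D f)) -UDf /U !mulmxA PcP mul1mx.
Qed.

Let q l : 'M[R]_n := \matrix_(i, j) complex.Re (conjc (P l i) * P l j).
Local Notation sp := (spec_fun d q).

Let spS (f : R -> R) : sp f = map_mx (@complex.Re R) (S (fun l => (f (d l))%:C)).
Proof.
apply/matrixP => i j; rewrite /spec_fun summxE /S !mxE.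
rewrite (raddf_sum (@complex.Re R : {additive Rcomplex R -> R})).
apply: eq_bigr => l _; rewrite mul_mx_diag !mxE.
by case: (P l i) (P l j) => a b [c e] /=; ring.
Qed.

Lemma unitary_diag_calculus (A : 'M[R]_n) :
  cmx A = Ph *m diag_mx (\row_l (d l)%:C) *m P ->
  [/\ forall l, eigenvalue A (d l), sp id = A, sp (fun=> 1) = 1%:M,
      forall f g, sp f *m sp g = sp (fun x => f x * g x)
    & forall f, (sp f)^T = sp f].
Proof.
move=> AE.
(* As A is real, so is every [S] built from a real function of d; taking real parts entrywise loses
   nothing, and identities can be checked over the complex numbers. *)
have SR f : cmx (sp f) = S (fun l => (f (d l))%:C).
  by rewrite spS cmx_Re// S_real// /S -AE conj_cmx.
split.
(* Row l of P is a complex left eigenvector; the characteristic polynomial brings the eigenvalue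
   back to the reals. *)
- move=> l; rewrite eigenvalue_root_char -(fmorph_root (real_complex R)).
  rewrite map_char_poly -eigenvalue_root_char; apply/eigenvalueP.
  exists (row l P).
    rewrite -[map_mx _ A]/(cmx A) AE !mulmxA -row_mul PPh row1 -[in LHS]mulmxA.
    by rewrite mulmxA -rowE row_diag_mx -scalemxAl -rowE mxE.
  apply/eqP => P0; have := congr1 (row l) PPh; rewrite row_mul P0 mul0mx row1.
  by move=> /rowP/(_ l); rewrite !mxE !eqxx => /esym/eqP; rewrite oner_eq0.
- by apply: cmx_inj; rewrite SR AE.
- by apply: cmx_inj; rewrite SR S1 cmx1.
- move=> f g; apply: cmx_inj; rewrite cmxM !SR SM; congr S.
  by apply/funext => l; rewrite rmorphM.
- move=> f; apply/matrixP => i j; rewrite mxE /spec_fun !summxE; apply: eq_bigr => l _.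
  rewrite !mxE; congr (_ * _).
  by case: (P l i) (P l j) => a b [c e] /=; ring.
Qed.

End Diag.

Theorem symmetric_calculus (A : 'M[R]_n) : A^T = A ->
  exists (d : 'I_n -> R) (q : 'I_n -> 'M[R]_n),
  [/\ forall l, eigenvalue A (d l), spec_fun d q id = A,
      spec_fun d q (fun=> 1) = 1%:M,
      forall f g, spec_fun d q f *m spec_fun d q g = spec_fun d q (fun x => f x * g x)
    & forall f, (spec_fun d q f)^T = spec_fun d q f].
Proof.
move=> /symmetric_unitary_diag[P [d [PPh AE]]].
by exists d; eexists; exact: (unitary_diag_calculus PPh AE).
Qed.

End SpectralCalculus.

(** * Uniqueness of the Moore-Penrose inverse *)

Section Pinv.
Variables (R : realType) (n : nat).
Implicit Types A X Y : 'M[R]_n.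

(** A X and A Y are symmetric and absorb each other, hence coincide; so do X A and Y A. Then X = X A
    X = Y A X = Y A Y = Y. *)
Lemma is_pinv_uniq A X Y : is_pinv A X -> is_pinv A Y -> X = Y.
Proof.
move=> [AXA XAX AXs XAs] [AYA YAY AYs YAs].
have AXY : A *m X = A *m Y.
  transitivity ((A *m X *m (A *m Y))^T).
    by rewrite trmx_mul AXs AYs !mulmxA AYA.
  by rewrite !mulmxA AXA AYs.
have XAY : X *m A = Y *m A.
  transitivity ((Y *m A *m (X *m A))^T).
    by rewrite trmx_mul XAs YAs -!mulmxA (mulmxA A Y) AYA.
  by rewrite -!mulmxA (mulmxA A X) AXA YAs.
by rewrite -XAX XAY -mulmxA AXY mulmxA YAY.
Qed.

Lemma pinvE A X : is_pinv A X -> Defs.pinv A = X.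
Proof.
move=> AX; rewrite /Defs.pinv; case: pselect => [h|[]]; last by exists X.
by apply: is_pinv_uniq AX; case: (cid h).
Qed.

End Pinv.

Lemma cvg_sum_seq (R : realType) (I : Type) (s : seq I) (u : I -> nat -> R) (a : I -> R) :
  (forall i, u i N @[N --> \oo] --> a i) ->
  \sum_(i <- s) u i N @[N --> \oo] --> \sum_(i <- s) a i.
Proof.
move=> h; elim: s => [|i s IH].
  rewrite big_nil; under eq_fun do rewrite big_nil; exact: cvg_cst.
rewrite big_cons; under eq_fun do rewrite big_cons; exact: cvgD.
Qed.

(** * Inverses, power series and complex symbols in the calculus *)

Section Calculus.
Variables (R : realType) (n : nat) (L : 'M[R]_n) (d : 'I_n -> R) (q : 'I_n -> 'M[R]_n).
Local Notation sp := (spec_fun d q).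
Hypothesis spL : sp id = L.
Hypothesis sp1 : sp (fun=> 1) = 1%:M.
Hypothesis spM : forall f g, sp f *m sp g = sp (fun x => f x * g x).
Hypothesis spT : forall f, (sp f)^T = sp f.

Lemma sp_ext f g : (forall l, f (d l) = g (d l)) -> sp f = sp g.
Proof. by move=> fg; apply: eq_bigr => l _; rewrite fg. Qed.

Lemma spD f g : sp f + sp g = sp (fun x => f x + g x).
Proof. by rewrite -big_split; apply: eq_bigr => l _; rewrite scalerDl. Qed.

Lemma spZ a f : a *: sp f = sp (fun x => a * f x).
Proof. by rewrite scaler_sumr; apply: eq_bigr => l _; rewrite scalerA. Qed.

Lemma sp0 : sp (fun=> 0) = 0.
Proof. by rewrite /spec_fun big1// => l _; rewrite scale0r. Qed.

Lemma spB f g : sp f - sp g = sp (fun x => f x - g x).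
Proof. by rewrite -scaleN1r spZ spD; apply: sp_ext => l; rewrite mulN1r. Qed.

Lemma spE f i j : sp f i j = \sum_l f (d l) * q l i j.
Proof. by rewrite summxE; apply: eq_bigr => l _; rewrite mxE. Qed.

Lemma sp_inv f : (forall l, f (d l) != 0) -> invmx (sp f) = sp (fun x => (f x)^-1).
Proof.
move=> f0; have h : sp f *m sp (fun x => (f x)^-1) = 1%:M.
  by rewrite spM -sp1; apply: sp_ext => l; rewrite divff.
have [u _] := mulmx1_unit h.
by rewrite -[LHS]mulmx1 -h mulmxA mulVmx// mul1mx.
Qed.

(** The convention 0^-1 = 0 matters: the scalar inverse is then a pseudo-inverse on every mode,
    including those where f vanishes. *)
Lemma sp_pinv f : Defs.pinv (sp f) = sp (fun x => (f x)^-1).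
Proof.
have e (a : R) : a * a^-1 * a = a.
  by have [->|a0] := eqVneq a 0; rewrite ?mulr0// divff// mul1r.
apply: pinvE; split; rewrite !spM ?spT//; apply: sp_ext => l; first exact: e.
by rewrite -{2}[f (d l)]invrK e.
Qed.

Lemma spX tau k : (tau *: L) ^+ k = sp (fun x => (tau * x) ^+ k).
Proof.
elim: k => [|k IH]; first by rewrite -[LHS]sp1.
rewrite exprS IH -spL spZ -[LHS]/(_ *m _) spM; apply: sp_ext => l.
by rewrite exprS.
Qed.

(** Exchanging the two finite sums turns each entry of a partial sum into a combination, over the
    modes, of scalar partial sums. *)
Lemma sp_series (tau : R) (c : nat -> R) (e : nat -> nat) (f : R -> R) i j :
  (forall x, \sum_(0 <= k < N) c k * x ^+ e k @[N --> \oo] --> f x) ->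
  limn (fun N => \sum_(0 <= k < N) c k * ((tau *: L) ^+ e k) i j) =
  sp (fun x => f (tau * x)) i j.
Proof.
move=> cf; apply/cvg_lim => //.
have -> : (fun N => \sum_(0 <= k < N) c k * ((tau *: L) ^+ e k) i j) =
    (fun N => \sum_l (\sum_(0 <= k < N) c k * (tau * d l) ^+ e k) * q l i j).
  apply/funext => N.
  under eq_bigr do rewrite spX spE mulr_sumr.
  rewrite exchange_big /=; apply: eq_bigr => l _; rewrite mulr_suml.
  by apply: eq_bigr => k _; rewrite mulrA.
rewrite spE; apply: cvg_sum_seq => l.
by apply: cvgM; [exact: cf|exact: cvg_cst].
Qed.

Lemma mx_cosE tau : mx_cos (tau *: L) = sp (fun x => cos (tau * x)).
Proof.
apply/matrixP => i j; rewrite mxE; apply: sp_series => x.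
have := @cvg_cos_coeff' R x; apply: cvg_trans; apply: near_eq_cvg; near=> N.
apply: eq_bigr => k _; rewrite /cos_coeff' mul2n -exprnP; ring.
Unshelve. all: end_near. Qed.

Lemma mx_sinE tau : mx_sin (tau *: L) = sp (fun x => sin (tau * x)).
Proof.
apply/matrixP => i j; rewrite mxE; apply: sp_series => x.
have := @cvg_sin_coeff' R x; apply: cvg_trans; apply: near_eq_cvg; near=> N.
apply: eq_bigr => k _; rewrite /sin_coeff' mul2n -exprnP; ring.
Unshelve. all: end_near. Qed.

Local Open Scope complex_scope.
Definition csp (f : R -> R[i]) : 'M[R[i]]_n := \sum_l f (d l) *: cmx (q l).

Lemma cspE f : csp f = cmx (sp (fun x => complex.Re (f x)))
  + 'i%C *: cmx (sp (fun x => complex.Im (f x))).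
Proof.
apply/matrixP => i j; rewrite /csp summxE !mxE !spE !rmorph_sum /= mulr_sumr -big_split.
apply: eq_bigr => l _ /=; rewrite !mxE.
case: (f (d l)) => a b; apply/eqP; rewrite eq_complex /=.
by apply/andP; split; apply/eqP; ring.
Qed.

Lemma csp_real (f : R -> R) : csp (fun x => (f x)%:C) = cmx (sp f).
Proof.
rewrite cspE /= [sp (fun=> 0)]sp0 (_ : cmx 0 = 0) ?scaler0 ?addr0//.
by apply/matrixP => i j; rewrite !mxE.
Qed.

Lemma csp_ext f g : (forall l, f (d l) = g (d l)) -> csp f = csp g.
Proof. by move=> fg; apply: eq_bigr => l _; rewrite fg. Qed.

Lemma cspD f g : csp f + csp g = csp (fun x => f x + g x).
Proof. by rewrite -big_split; apply: eq_bigr => l _; rewrite scalerDl. Qed.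

Lemma cspZ a f : a *: csp f = csp (fun x => a * f x).
Proof. by rewrite scaler_sumr; apply: eq_bigr => l _; rewrite scalerA. Qed.

(** [spM] covers real functions only, so the product is expanded into real and imaginary parts. *)
Lemma cspM f g : csp f *m csp g = csp (fun x => f x * g x).
Proof.
have eRe : sp (fun x => complex.Re (f x * g x)) =
    sp (fun x => complex.Re (f x) * complex.Re (g x))
    - sp (fun x => complex.Im (f x) * complex.Im (g x)).
  by rewrite spB; apply: sp_ext => l; case: (f _) (g _) => a b [].
have eIm : sp (fun x => complex.Im (f x * g x)) =
    sp (fun x => complex.Re (f x) * complex.Im (g x))
    + sp (fun x => complex.Im (f x) * complex.Re (g x)).
  by rewrite spD; apply: sp_ext => l; case: (f _) (g _) => a b [].
rewrite [RHS]cspE eRe eIm !cspE mulmxDl !mulmxDr -!scalemxAl -!scalemxAr -!cmxM !spM.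
rewrite scalerA -expr2 sqr_i scaleN1r cmxB cmxD scalerDr -!addrA.
by congr (_ + _); rewrite addrA addrC.
Qed.

Lemma conj_csp f : map_mx conjc (csp f) = csp (fun x => conjc (f x)).
Proof.
apply/matrixP => i j; rewrite mxE /csp !summxE rmorph_sum /=.
by apply: eq_bigr => l _; rewrite !mxE rmorphM /= oppr0.
Qed.

Lemma csp_tr f : (csp f)^T = csp f.
Proof. by rewrite cspE linearD linearZ /= -!cmx_tr !spT. Qed.

Lemma csp_inv f : (forall l, f (d l) != 0) -> invmx (csp f) = csp (fun x => (f x)^-1).
Proof.
move=> f0; have h : csp f *m csp (fun x => (f x)^-1) = 1%:M.
  rewrite cspM -(cmx1 R) -sp1 -csp_real; apply: csp_ext => l.
  by rewrite divff.
have [u _] := mulmx1_unit h.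
by rewrite -[LHS]mulmx1 -h mulmxA mulVmx// mul1mx.
Qed.

End Calculus.

(** * Graph Laplacians *)

Section Graph.
Variables (R : realType) (n m : nat) (src dst : 'I_m -> 'I_n) (w : 'I_m -> R).
Hypothesis n0 : (0 < n)%N.
Hypothesis loopless : forall k, src k != dst k.
Hypothesis w0 : forall k, 0 < w k.
Hypothesis conn : forall i j, connect (graph_adj src dst) i j.
Local Notation E := (incidence R src dst).
Local Notation L := (laplacian src dst w).
Local Notation M := (centering R n).

Lemma laplacian_sym : L^T = L.
Proof. by rewrite /laplacian !trmx_mul trmxK tr_diag_mx mulmxA. Qed.

Lemma mul_incidence p (A : 'M[R]_(p, n)) i k :
  (A *m E) i k = A i (src k) - A i (dst k).
Proof.
rewrite mxE (bigD1 (src k))//= (bigD1 (dst k)) 1?eq_sym//= !mxE eqxx.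
rewrite [dst k == src k]eq_sym (negbTE (loopless k)) eqxx mulr1 mulrN1.
rewrite big1 ?addr0// => j /andP[/negbTE j1 /negbTE j2].
by rewrite mxE j1 j2 mulr0.
Qed.

Lemma laplacian_form (v : 'rV[R]_n) :
  (v *m L *m v^T) 0 0 = \sum_k w k * (v 0 (src k) - v 0 (dst k)) ^+ 2.
Proof.
have -> : v *m L *m v^T = v *m E *m diag_mx (\row_k w k) *m (v *m E)^T.
  by rewrite /laplacian trmx_mul !mulmxA.
rewrite mxE; apply: eq_bigr => k _.
rewrite mul_mx_diag mxE mul_incidence [(v *m E)^T _ _]mxE mul_incidence mxE.
ring.
Qed.

Lemma laplacian_eigenvalue_ge0 mu : eigenvalue L mu -> 0 <= mu.
Proof.
move=> /eigenvalueP[v vL v0].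
have : 0 <= (v *m L *m v^T) 0 0.
  rewrite laplacian_form sumr_ge0// => k _.
  by rewrite mulr_ge0 ?sqr_ge0// ltW.
rewrite vL -scalemxAl mxE pmulr_lge0//.
have vv : 0 <= (v *m v^T) 0 0.
  by rewrite mxE sumr_ge0// => i _; rewrite mxE -expr2 sqr_ge0.
rewrite lt_neqAle vv andbT eq_sym; apply: contra v0.
rewrite mxE psumr_eq0; last by move=> i _; rewrite mxE -expr2 sqr_ge0.
move=> /allP h; apply/eqP/rowP => i; have := h i (mem_index_enum _).
by rewrite mxE -expr2 sqrf_eq0 => /eqP ->; rewrite mxE.
Qed.

Lemma centering_laplacian : M *m L = L.
Proof.
rewrite /centering mulmxBl mul1mx -scalemxAl.
have -> : (const_mx 1 : 'M[R]_n) *m L = 0.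
  rewrite /laplacian !mulmxA.
  have -> : (const_mx 1 : 'M[R]_n) *m E = 0.
    by apply/matrixP => i k; rewrite mul_incidence !mxE subrr.
  by rewrite !mul0mx.
by rewrite scaler0 subr0.
Qed.

(** A kernel vector has zero Dirichlet energy, so it agrees at both ends of each link; connectedness
    spreads this along paths. *)
Lemma laplacian_ker (z : 'cV[R]_n) : L *m z = 0 -> forall i j, z i 0 = z j 0.
Proof.
move=> Lz.
have zE k : z (src k) 0 = z (dst k) 0.
  have : (z^T *m L *m z^T^T) 0 0 = 0 by rewrite trmxK -mulmxA Lz mulmx0 mxE.
  rewrite laplacian_form => /eqP.
  rewrite psumr_eq0; last by move=> k' _; rewrite mulr_ge0 ?sqr_ge0// ltW.
  move=> /allP/(_ k (mem_index_enum _)) /=.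
  by rewrite mulf_eq0 gt_eqF//= sqrf_eq0 subr_eq0 !mxE => /eqP.
move=> i j; have /connectP[p] := conn i j.
elim: p i => [|k p IH] i /=; first by move=> _ ->.
move=> /andP[/existsP[e ek] kp] jE; rewrite -(IH k kp jE).
by move: ek => /orP[] /andP[/eqP <- /eqP <-]; rewrite zE.
Qed.

Lemma centering_ker (Z : 'M[R]_n) : L *m Z = 0 -> M *m Z = 0.
Proof.
move=> LZ; apply/matrixP => i j.
have h : forall i1 i2, Z i1 j = Z i2 j.
  move=> i1 i2; have := @laplacian_ker (col j Z) _ i1 i2; rewrite !mxE; apply.
  by rewrite colE mulmxA LZ mul0mx.
rewrite /centering mulmxBl mul1mx -scalemxAl !mxE.
have -> : \sum_j0 const_mx 1 i j0 * Z j0 j = n%:R * Z i j.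
  rewrite (eq_bigr (fun=> Z i j)) => [|k _]; last by rewrite mxE mul1r (h k i).
  by rewrite sumr_const card_ord mulr_natl.
by rewrite mulrA mulVf ?mul1r ?subrr// pnatr_eq0 -lt0n.
Qed.

End Graph.

(** * The noisy consensus network *)

Section Network.
Variables (R : realType) (n m : nat) (src dst : 'I_m -> 'I_n) (w : 'I_m -> R).
Variables (tau lam : R).
Hypothesis n0 : (0 < n)%N.
Hypothesis loopless : forall k, src k != dst k.
Hypothesis w0 : forall k, 0 < w k.
Hypothesis conn : forall i j, connect (graph_adj src dst) i j.
Local Notation E := (incidence R src dst).
Local Notation L := (laplacian src dst w).
Local Notation M := (centering R n).
Local Notation mu := (@lebesgue_measure R).
Hypothesis lam_max : forall a, eigenvalue L a -> a <= lam.
Hypothesis tau0 : 0 <= tau.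
Hypothesis lamtau : tau * lam < pi / 2.
Variables (d : 'I_n -> R) (q : 'I_n -> 'M[R]_n).
Local Notation sp := (spec_fun d q).
Hypothesis eig : forall l, eigenvalue L (d l).
Hypothesis spL : sp id = L.
Hypothesis sp1 : sp (fun=> 1) = 1%:M.
Hypothesis spM : forall f g, sp f *m sp g = sp (fun x => f x * g x).
Hypothesis spT : forall f, (sp f)^T = sp f.

Let nz (x : R) : R := (x != 0)%:R.

Let d0 l : 0 <= d l.
Proof. by apply: (laplacian_eigenvalue_ge0 loopless w0); exact: eig. Qed.

Let dtau l : tau * d l < pi / 2.
Proof. by apply: le_lt_trans lamtau; rewrite ler_wpM2l// lam_max. Qed.

(** The part on nonzero eigenvalues factors through L, so M fixes it; L annihilates the
    complementary part, so by connectedness its columns are constant and M kills them. *)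
Lemma centering_spec : M = sp nz.
Proof.
have nzE : sp nz = L *m sp (fun x => x^-1).
  rewrite -spL spM; apply: sp_ext => l; rewrite /nz.
  by have [->|dl] := eqVneq (d l) 0; rewrite ?mul0r ?divff.
have h0 : M *m sp (fun x => 1 - nz x) = 0.
  apply: (centering_ker n0 loopless w0 conn).
  rewrite -spL spM -(sp0 d q); apply: sp_ext => l; rewrite /nz.
  by have [->|dl] := eqVneq (d l) 0; rewrite ?mul0r ?subrr ?mulr0.
have h1 : M *m sp nz = sp nz by rewrite nzE mulmxA centering_laplacian.
have : sp nz + sp (fun x => 1 - nz x) = 1%:M.
  by rewrite spD -sp1; apply: sp_ext => l; rewrite addrC subrK.
by move/(congr1 (mulmx M)); rewrite mulmxDr h0 addr0 h1 mulmx1.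
Qed.

Let coef l k : R := (E^T *m q l *m E) k k.

Lemma incidence_form f k :
  (E^T *m sp f *m E) k k = \sum_l f (d l) * coef l k.
Proof.
rewrite /spec_fun mulmx_sumr mulmx_suml summxE; apply: eq_bigr => l _.
by rewrite -scalemxAr -scalemxAl mxE.
Qed.

(** The symbol of the matrix inside [eff_res]. Its factor x allows 1 in place of [nz x], and its
    inverse is [delay_gain x tau / x]. *)
Let target x : R := x * (1 - sin (tau * x)) / cos (tau * x).

(** For a symmetric pseudo-inverse Y, the effective resistance of link e is the diagonal entry (E^T
    Y E)_ee. *)
Lemma eff_res_spec e :
  eff_res (L *m invmx (mx_cos (tau *: L)) *m (M - mx_sin (tau *: L)))
     (src e) (dst e) = \sum_l (target (d l))^-1 * coef l e.
Proof.
have cos0 l : cos (tau * d l) != 0.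
  rewrite gt_eqF// cos_gt0_pihalf// dtau andbT.
  have : 0 <= tau * d l by rewrite mulr_ge0.
  have := pi_gt0 R; lra.
rewrite centering_spec (mx_cosE spL sp1 spM) (mx_sinE spL sp1 spM).
rewrite (sp_inv sp1 spM cos0) -{1}spL spM spB spM.
rewrite (@sp_ext _ _ _ _ _ target); last first.
  move=> l; rewrite /target /nz.
  by have [->|dl] := eqVneq (d l) 0; rewrite ?mul0r// /=; ring.
rewrite /eff_res (sp_pinv spM spT) -(incidence_form (fun x => (target x)^-1)).
set Y := sp _; have YT : Y^T = Y by rewrite spT.
rewrite mul_incidence//.
have EY i : (E^T *m Y) e i = Y (src e) i - Y (dst e) i.
  have -> : (E^T *m Y) e i = (Y *m E) i e by rewrite -YT -trmx_mul mxE YT.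
  by rewrite mul_incidence// -{1}YT -{2}YT !mxE.
rewrite !EY; have -> : Y (dst e) (src e) = Y (src e) (dst e) by rewrite -{1}YT mxE.
ring.
Qed.

Local Open Scope complex_scope.

Let symb (om x : R) : R[i] :=
  (0 +i* om) + (cos (om * tau) -i* sin (om * tau)) * x%:C.

Let normsymb om x : conjc (symb om x) * symb om x = (delay_den x tau om)%:C.
Proof.
rewrite /symb /delay_den (mulrC tau om); have := cos2Dsin2 (om * tau).
move: (cos _) (sin _) => c s cs.
apply/eqP; rewrite eq_complex /=; apply/andP; split; apply/eqP; last by ring.
have -> : x ^+ 2 = x ^+ 2 * (c ^+ 2 + s ^+ 2) by rewrite cs mulr1.
ring.
Qed.

(** On a zero mode the symbol is i om, whence the condition on om; on positive modes its squared
    modulus is a positive [delay_den]. *)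
Let symb0 om l : om != 0 -> symb om (d l) != 0.
Proof.
move=> om0; apply/eqP => h.
have := normsymb om (d l); rewrite h mulr0 => -[] /esym/eqP; apply/negP.
have [dl|dl] := eqVneq (d l) 0.
  by rewrite /delay_den dl !(mulr0, mul0r, expr0n) /= add0r subr0 sqrf_eq0.
by rewrite gt_eqF// delay_den_gt0// lt_neqAle eq_sym dl d0.
Qed.

(** In the calculus the resolvent and its adjoint multiply to 1 / |symb|^2, and M contributes the
    projector [nz]. Diagonal noise scaling leaves sg_k^2 times a diagonal entry of E^T Y E. *)
Lemma transfer_trace (sg : 'I_m -> R) om : om != 0 ->
  complex.Re (\tr ((map_mx conjc (transfer L E sg tau om))^T
                   *m transfer L E sg tau om)) =
  \sum_k sg k ^+ 2 * \sum_l nz (d l) / delay_den (d l) tau om * coef l k.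
Proof.
move=> om0; rewrite /transfer.
set S := - E *m _.
have -> : (0 +i* om) *: 1%:M + (cos (om * tau) -i* sin (om * tau)) *: cmx L
    = csp d q (symb om).
  rewrite -spL -csp_real cspZ -(cmx1 R) -sp1 -csp_real cspZ cspD.
  by apply: csp_ext => l; rewrite /symb mulr1.
rewrite (csp_inv sp1 spM); last by move=> l; exact: symb0.
rewrite centering_spec -csp_real (cspM spM).
rewrite map_mxM trmx_mul conj_csp conj_cmx (csp_tr spT) -mulmxA (mulmxA (csp _ _ _)).
rewrite (cspM spM) (@csp_ext _ _ _ _ _ (fun x => (nz x / delay_den x tau om)%:C)); last first.
  move=> l; have sne := symb0 l om0.
  have dne : (delay_den (d l) tau om)%:C != 0.
    by rewrite -normsymb mulf_neq0// conjc_eq0.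
  have -> : (nz (d l) / delay_den (d l) tau om)%:C =
      (nz (d l))%:C / (delay_den (d l) tau om)%:C by rewrite rmorphM fmorphV.
  rewrite -normsymb.
  have -> : conjc ((nz (d l))%:C / symb om (d l)) = (nz (d l))%:C / conjc (symb om (d l)).
    by rewrite rmorphM fmorphV; congr (_ / _); exact: conjc_real.
  rewrite mulf_div; congr (_ / _); rewrite -rmorphM; congr (_%:C).
  by rewrite /nz; case: eqP; rewrite /= ?mulr0 ?mulr1.
rewrite csp_real -cmx_tr -!cmxM; set Y := sp _.
have -> : S^T *m (Y *m S) =
    diag_mx (\row_k sg k) *m (E^T *m Y *m E) *m diag_mx (\row_k sg k).
  rewrite /S mulNmx linearN /= mulmxN mulNmx mulmxN opprK trmx_mul tr_diag_mx.
  by rewrite !mulmxA.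
have trC (X : 'M[R]_m) : complex.Re (\tr (cmx X)) = \tr X.
  have -> : \tr (cmx X) = (\tr X)%:C.
    by rewrite /mxtrace rmorph_sum /=; apply: eq_bigr => k _; rewrite mxE.
  by [].
rewrite trC /mxtrace; apply: eq_bigr => k _.
rewrite -(incidence_form (fun x => nz x / delay_den x tau om)).
rewrite mul_mx_diag mul_diag_mx; move: (E^T *m _ *m E) => X.
by rewrite !mxE; ring.
Qed.

Let gainsum k : R :=
  \sum_l nz (d l) * (pi / d l * delay_gain (d l) tau) * coef l k.

(** The integrand is positive, so the finite value in [integral_delay_denV] is already
    integrability. *)
Let integrable_den l : nz (d l) != 0 ->
  mu.-integrable setT (EFin \o (fun om => (delay_den (d l) tau om)^-1)).
Proof.
rewrite /nz pnatr_eq0 eqb0 negbK => dl.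
have dl0 : 0 < d l by rewrite lt_neqAle eq_sym dl d0.
apply/integrableP; split.
  apply/measurable_EFinP; apply: continuous_measurable_fun.
  exact: (continuous_delay_denV dl0 tau0 (dtau l)).
have -> : (\int[mu]_om `|(EFin \o (fun om => (delay_den (d l) tau om)^-1%R)) om| =
    \int[mu]_om ((delay_den (d l) tau om)^-1)%:E)%E.
  apply: eq_integral => om _ /=; rewrite gtr0_norm// invr_gt0.
  exact: (delay_den_gt0 dl0 tau0 (dtau l)).
by rewrite (integral_delay_denV dl0 tau0 (dtau l)) ltry.
Qed.

Let integral_term l :
  mu.-integrable setT (EFin \o (fun om => nz (d l) / delay_den (d l) tau om)) /\
  (\int[mu]_om (nz (d l) / delay_den (d l) tau om)%:E =
   (nz (d l) * (pi / d l * delay_gain (d l) tau))%:E)%E.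
Proof.
have [h|h] := eqVneq (nz (d l)) 0.
  rewrite h mul0r; split.
    apply: (eq_integrable _ (cst 0%E)) => //.
      by move=> om _ /=; rewrite mul0r.
    exact: integrable0.
  by rewrite (eq_integral (cst 0%E)) ?integral0// => om _; rewrite mul0r.
have i1 := integrable_den h.
have dl0 : 0 < d l.
  by move: h; rewrite /nz pnatr_eq0 eqb0 negbK => dl; rewrite lt_neqAle eq_sym dl d0.
split; first exact: (integrableZl _ (nz (d l)) i1).
under eq_integral do rewrite EFinM.
by rewrite (integralZl _ i1)// (integral_delay_denV dl0 tau0 (dtau l)).
Qed.

Lemma rho_ss_spec (s2 : 'I_m -> R) : (forall k, 0 <= s2 k) ->
  rho_ss L E tau s2 = (2 * pi)^-1 * \sum_k s2 k * gainsum k.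
Proof.
move=> s0; rewrite /rho_ss; congr (_ * _).
pose term k l om := (s2 k * coef l k) * (nz (d l) / delay_den (d l) tau om).
have iterm k l : mu.-integrable setT (EFin \o term k l).
  exact: (integrableZl _ (s2 k * coef l k) (integral_term l).1).
pose F om : \bar R := (\sum_k \sum_l (term k l om)%:E)%E.
have iF : mu.-integrable setT F.
  by apply: integrable_sum => // k _; apply: integrable_sum => // l _; exact: iterm.
have FE om : om != 0 -> (complex.Re (\tr ((map_mx conjc
    (transfer L E (fun k => Num.sqrt (s2 k)) tau om))^T
    *m transfer L E (fun k => Num.sqrt (s2 k)) tau om)))%:E = F om.
  move=> om0; rewrite transfer_trace// -sumEFin; apply: eq_bigr => k _.
  rewrite sqr_sqrtr// mulr_sumr -sumEFin; apply: eq_bigr => l _.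
  by congr (_%:E); rewrite /term; ring.
(* The formula for the trace holds for om != 0 only, so both integrals are compared after removing
   the null set {0}. *)
have -> : (\int[mu]_(omega in setT) (complex.Re (\tr ((map_mx conjc
    (transfer L E (fun k => Num.sqrt (s2 k)) tau omega))^T
    *m transfer L E (fun k => Num.sqrt (s2 k)) tau omega)))%:E = \int[mu]_om F om)%E.
  have mD : measurable (setT `\ (0 : R)) by apply: measurableD => //; exact: measurable_set1.
  have mF : measurable_fun (setT `\ (0 : R)) F.
    by apply: measurable_funTS; exact: (measurable_int mu iF).
  rewrite -(integral_setD1 mD); last first.
    apply: eq_measurable_fun mF => om; rewrite inE => -[_ /eqP om0].
    by rewrite FE.
  rewrite -[RHS](integral_setD1 mD mF); apply: eq_integral => om.
  by rewrite inE => -[_ /eqP om0]; rewrite FE.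
have -> : (\int[mu]_om F om = (\sum_k s2 k * gainsum k)%:E)%E.
  rewrite /F integral_sum// => [|k]; last first.
    by apply: integrable_sum => // l _; exact: iterm.
  rewrite -sumEFin; apply: eq_bigr => k _.
  rewrite integral_sum// => [|l]; last exact: iterm.
  rewrite mulr_sumr -sumEFin; apply: eq_bigr => l _.
  under eq_integral do rewrite EFinM.
  rewrite (integralZl _ (integral_term l).1)// (integral_term l).2 -EFinM.
  by congr (_%:E); ring.
by [].
Qed.

Lemma rho_ss_derive (s2 : 'I_m -> R) e : (forall k, 0 < s2 k) ->
  is_derive (s2 e) 1 (fun t => rho_ss L E tau (fun k => if k == e then t else s2 k))
    (2^-1 * eff_res (L *m invmx (mx_cos (tau *: L)) *m (M - mx_sin (tau *: L)))
       (src e) (dst e)).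
Proof.
move=> s0.
pose c : R := \sum_(k | k != e) s2 k * gainsum k.
pose f (t : R) : R := ((2 * pi)^-1 * gainsum e) * t + (2 * pi)^-1 * c.
(* The performance is affine in t only where [Num.sqrt t] squares back to t; positivity of [s2 e]
   provides a neighbourhood of such t. *)
have fE : {near s2 e, f =1 (fun t => rho_ss L E tau (fun k => if k == e then t else s2 k))}.
  have : \forall t \near s2 e, 0 < t
    by exact: lt_nbhsr (s0 e).
  apply: filterS => t t0; rewrite rho_ss_spec => [|k]; last by case: eqP => _; exact: ltW.
  rewrite (bigD1 e)//= eqxx mulrDr /f /c (mulrC t) -mulrA; congr (_ + _ * _).
  by apply: eq_bigr => k /negbTE ->.
apply: near_eq_is_derive fE _.
have h := is_deriveD (is_deriveZ ((2 * pi)^-1 * gainsum e) (is_derive_id (s2 e) (1 : R)))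
  (is_derive_cst ((2 * pi)^-1 * c) (s2 e) (1 : R)).
apply: (is_derive_eq h); rewrite eff_res_spec addr0 -[_ *: _]/(_ * _) mulr1.
rewrite /gainsum !mulr_sumr; apply: eq_bigr => l _.
have pi0 := pi_gt0 R.
(* For x = d_l nonzero, (2 pi)^-1 (pi / x) [delay_gain x tau] is half of 1 / [target x]. At x = 0
   both sides vanish, by [nz 0 = 0] and 0^-1 = 0. *)
rewrite /target /delay_gain /nz; have [->|dl] := eqVneq (d l) 0.
  by rewrite !mul0r invr0 mul0r !mulr0.
have dl0 : 0 < d l by rewrite lt_neqAle eq_sym dl d0.
rewrite !invfM invrK /= mul1r.
have -> : 2^-1 / pi * (pi / d l * (cos (tau * d l) / (1 - sin (tau * d l))) * coef l e) =
    (pi^-1 * pi) * (2^-1 * ((d l)^-1 * (1 - sin (tau * d l))^-1 * cos (tau * d l) * coef l e)).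
  by ring.
by rewrite mulVf ?mul1r// gt_eqF.
Qed.

End Network.

Local Close Scope classical_set_scope.


Theorem theorem10 (R : realType) (n m : nat) (src dst : 'I_m -> 'I_n)
  (w : 'I_m -> R) (tau lam : R) (s2 : 'I_m -> R) (e : 'I_m) :
  (0 < n)%N ->
  (forall k, src k != dst k) ->
  (forall k k', k != k' ->
     [set src k; dst k] != [set src k'; dst k'] :> {set 'I_n}) ->
  (forall k, 0 < w k) ->
  (forall i j, connect (graph_adj src dst) i j) ->
  eigenvalue (laplacian src dst w) lam ->
  (forall mu, eigenvalue (laplacian src dst w) mu -> mu <= lam) ->
  0 <= tau -> tau * lam < pi / 2 ->
  (forall k, 0 < s2 k) ->
  let L := laplacian src dst w in
  let E := incidence R src dst in
  let rho := fun t => rho_ss L E tau (fun k => if k == e then t else s2 k) in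
  derivable rho (s2 e) 1 /\
  derive1 rho (s2 e) =
    2^-1 * eff_res (L *m invmx (mx_cos (tau *: L))
                      *m (centering R n - mx_sin (tau *: L)))
                   (src e) (dst e).
Proof.
move=> n0 loopless _ w0 conn _ lam_max tau0 lamtau s0 L E rho.
have [d [q [eig spL sp1 spM spT]]] := symmetric_calculus (laplacian_sym src dst w).
have h := rho_ss_derive n0 loopless w0 conn lam_max tau0 lamtau eig spL sp1 spM spT e s0.
have hd := @ex_derive _ _ _ _ _ _ _ h.
have hv := @derive_val _ _ _ _ _ _ _ h.
split; first exact: hd.
by rewrite derive1E; exact: hv.
Qed.
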